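(* Let $n\ge 2$ and consider the set $$G=\Big\{x\in\mathbb{R} : x=\sum_{i=1}^n \Re(\lambda_i)\ \text{for some } \lambda_1,\dots,\lambda_n\in\mathbb{C}\text{ such that } |\lambda_i|=1 \text{ for all } i,\ \prod_{i=1}^n\lambda_i=1,\ \Im(\lambda_1)=\dots=\Im(\lambda_n)\Big\}.$$ Then $G$ is a finite set, $n\in G$ and $n=\max(G)$. Furthermore, letting $\delta$ be the maximal element of the set $G\setminus\{n\}$, we have that, for all $q=(t_0,W_{t_0})\in\mathbb{R}\times\mathrm{SU}(n)$, $$V(W_{t_0})>\delta\ \Longrightarrow\ \lim_{t\to\infty}W_q(t)=I,$$ where $W_q:\mathbb{R}\to\mathrm{SU}(n)$ is the solution of the auxiliary system $$\dot W = W X_r^\dagger(t)\sum_{k=1}^m f_k\,a_k(t,W)\,H_kX_r(t),\qquad a_k(t,W)=f_k\,V\big(WX_r^\dagger(t)H_kX_r(t)\big),$$ with initial condition $W_q(t_0)=W_{t_0}$.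
   Context: $M^n$ is the Banach space of $n\times n$ complex matrices with the Euclidean norm, $I$ is the identity matrix, and ${}^\dagger$ denotes conjugate transpose. $V:M^n\to\mathbb{R}$ is defined by $V(X)=\Re(\mathrm{tr}(X))$. Let $H_1,\dots,H_m\in\mathfrak{su}(n)$ and consider the driftless control system $\dot X=\sum_{k=1}^m u_kH_kX$, $X(0)=I$, with $X\in M^n$ and controls $u_k\in\mathbb{R}$. Definition (regular). The system is regular when, given $T>0$, there exist smooth $T$-periodic functions $u^T_k:\mathbb{R}\to\mathbb{R}$, $1\le k\le m$, such that the solution $X_r^T$ of $\dot X_r^T=\sum_{k=1}^m u_k^T(t)H_kX_r^T$, $X_r^T(0)=I$ (which takes values in $\mathrm{SU}(n)$) is also periodic of period $T$ and satisfies $$\mathrm{span}_{\mathbb{R}}\{B_k^j(0): 1\le k\le m,\ j\in\mathbb{N}\}=\mathfrak{su}(n),$$ where $\mathbb{N}$ includes $0$, $A(t)=\sum_{k=1}^m u_k^T(t)H_k$, $B_k^0(t)=H_kX_r^T(t)$ and $B_k^{j+1}(t)=-A(t)B_k^j(t)+\dot B_k^j(t)$. Standing assumptions: the system is regular; $T>0$ is fixed, and $u_k^T$, $X_r^T$ are fixed as in the definition of regularity for this $T$; $X_\infty\in\mathrm{SU}(n)$ is fixed; $X_r:\mathbb{R}\to\mathrm{SU}(n)$ is $X_r(t)=X_r^T(t)X_\infty$; and $f_1,\dots,f_m$ are fixed nonzero real numbers. *)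

(* Defs.v *)
From mathcomp Require Import all_boot all_order all_algebra.
From mathcomp Require Import complex.
From mathcomp Require Import all_classical all_reals all_analysis.

Set Implicit Arguments.
Unset Strict Implicit.
Unset Printing Implicit Defensive.

Import Order.TTheory GRing.Theory Num.Theory.
Import numFieldNormedType.Exports.

Local Open Scope classical_set_scope.
Local Open Scope ring_scope.
Local Open Scope complex_scope.
Local Open Scope sesquilinear_scope.

(* The maximum of a set, as opposed to its (totalized) supremum. *)
Definition is_max (R : realType) (A : set R) (x : R) : Prop :=
  A x /\ ubound A x.

Definition smooth (R : realType) (f : R -> R) : Prop :=
  forall (j : nat) (t : R), derivable (derive1n j f) t 1.

Section Matrices.
Variables (R : realType) (n : nat).
Implicit Types (X Y : 'M[R[i]]_n) (F : R -> 'M[R[i]]_n).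

Definition V X : R := complex.Re (\tr X).

Definition SU : set 'M[R[i]]_n := [set X | X \is unitarymx /\ \det X = 1].

Definition su : set 'M[R[i]]_n := [set X | X^t* = - X /\ \tr X = 0].

Definition euclidean_norm X : R :=
  Num.sqrt (\sum_(i < n) \sum_(j < n)
    (complex.Re (X i j) ^+ 2 + complex.Im (X i j) ^+ 2)).

Definition cvg_mx F (L : 'M[R[i]]_n) : Prop :=
  euclidean_norm (F t - L) @[t --> +oo] --> (0 : R).

(* The library makes the matrices over R[i] a normed space over R[i], not over
   R, so curves R -> 'M[R[i]]_n are differentiated through the real and
   imaginary parts of their entries. *)
Definition is_derive_mx F (t : R) (D : 'M[R[i]]_n) : Prop :=
  forall i j,
    is_derive t 1 (fun s => complex.Re (F s i j)) (complex.Re (D i j)) /\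
    is_derive t 1 (fun s => complex.Im (F s i j)) (complex.Im (D i j)).

(* Total operator: meaningful at the points where F is differentiable. *)
Definition derive_mx F (t : R) : 'M[R[i]]_n :=
  \matrix_(i, j) (derive1 (fun s => complex.Re (F s i j)) t
                  +i* derive1 (fun s => complex.Im (F s i j)) t).

Definition real_span (S : set 'M[R[i]]_n) : set 'M[R[i]]_n :=
  [set Z | exists (N : nat) (c : 'I_N -> R) (Y : 'I_N -> 'M[R[i]]_n),
     (forall l, S (Y l)) /\ Z = \sum_(l < N) (c l)%:C *: Y l].

End Matrices.

Arguments SU : clear implicits.
Arguments su : clear implicits.

Section ControlSystem.
Variables (R : realType) (n m : nat) (H : 'I_m -> 'M[R[i]]_n).

Definition control_mx (u : 'I_m -> R -> R) (t : R) : 'M[R[i]]_n :=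
  \sum_(k < m) (u k t)%:C *: H k.

Fixpoint bracket (u : 'I_m -> R -> R) (X : R -> 'M[R[i]]_n) (k : 'I_m)
    (j : nat) : R -> 'M[R[i]]_n :=
  if j is j'.+1 then
    fun t => - control_mx u t *m bracket u X k j' t
             + derive_mx (bracket u X k j') t
  else fun t => H k *m X t.

Record regular_reference (T : R) (u : 'I_m -> R -> R)
    (X : R -> 'M[R[i]]_n) : Prop := RegularReference {
  ref_smooth : forall k, smooth (u k);
  ref_control_periodic : forall k, periodic (u k) T;
  ref_init : X 0 = 1%:M;
  ref_ode : forall t, is_derive_mx X t (control_mx u t *m X t);
  ref_periodic : periodic X T;
  ref_span :
    real_span [set Z | exists (k : 'I_m) (j : nat), Z = bracket u X k j 0]
    = su R n
}.

Definition regular : Prop :=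
  forall T : R, 0 < T ->
  exists (u : 'I_m -> R -> R) (X : R -> 'M[R[i]]_n), regular_reference T u X.

Variables (f : 'I_m -> R) (Xr : R -> 'M[R[i]]_n).

Definition feedback (k : 'I_m) (t : R) (W : 'M[R[i]]_n) : R :=
  f k * V (W *m (Xr t)^t* *m H k *m Xr t).

Definition aux_field (t : R) (W : 'M[R[i]]_n) : 'M[R[i]]_n :=
  W *m (Xr t)^t* *m \sum_(k < m) (f k * feedback k t W)%:C *: (H k *m Xr t).

(* The equation is posed in the whole matrix space: that a solution starting
   in SU stays there is a consequence of the equation, not a requirement. *)
Definition aux_solution (t0 : R) (W0 : 'M[R[i]]_n)
    (W : R -> 'M[R[i]]_n) : Prop :=
  W t0 = W0 /\ forall t, is_derive_mx W t (aux_field t (W t)).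

End ControlSystem.

Definition G (R : realType) (n : nat) : set R :=
  [set x | exists lambda : 'I_n -> R[i],
     [/\ x = \sum_(i < n) complex.Re (lambda i),
         forall i, `|lambda i| = 1,
         \prod_(i < n) lambda i = 1 &
         forall i j, complex.Im (lambda i) = complex.Im (lambda j)]].

Arguments G : clear implicits.

(* Main.v *)
(* Along the auxiliary system V(W) is nondecreasing, its derivative being the sum
   of the squares of the a_k.  By Barbalat's lemma the a_k, hence W', tend to 0.
   So any cluster point L of the samples W(jT) satisfies V(L S_k(s)) = 0 for all
   k and s, where S_k = X_r^* H_k X_r is T-periodic.  Differentiating in s at 0,
   regularity gives V(L Z) = 0 for every Z in su(n); then L - L^* is scalar, the
   eigenvalues of L have a common imaginary part, and V(L) lies in G.  As
   V(L) >= V(W(t_0)) > delta, V(L) = n, and |W - I|^2 = 2 (n - V(W)) tends to 0. *)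
Require Import Defs.
From mathcomp Require Import all_boot all_order all_algebra.
From mathcomp Require Import perm complex spectral.
From mathcomp Require Import all_classical all_reals all_analysis.
From mathcomp Require Import ring lra.

Set Implicit Arguments.
Unset Strict Implicit.
Unset Printing Implicit Defensive.

Import Order.TTheory GRing.Theory Num.Theory.
Import numFieldNormedType.Exports.

Local Open Scope classical_set_scope.
Local Open Scope ring_scope.
Local Open Scope complex_scope.
Local Open Scope sesquilinear_scope.

(** * Complex-valued curves *)

(** The auxiliary system is not autonomous, so the invariance of limit sets is replaced by sampling
    at multiples of T. As S_k(s + jT) = S_k(s) and W' tends to 0, the samples W(s + jT) and W(jT)
    have the same limit; a single L therefore satisfies the equations for every s, and an identity
    in s may be differentiated. Differentiation meets regularity because the derivative of X_r^* is
    - X_r^* A: in the product X_r^* B_k^j X_inf the rule B -> - A B + B' becomes the ordinary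
    derivative, so that the j-th derivative of S_k at 0 is X_inf^* B_k^j(0) X_inf, and conjugation
    by X_inf maps su(n) onto itself. The derivative in the brackets is a total operator, so their
    differentiability at every order has to be established first. For the pairing A, B -> V(A^* B),
    the condition on L says that its skew-Hermitian part is orthogonal to su(n), which leaves only
    imaginary scalars. Finiteness of G separates n from the other critical values. *)

Section ComplexParts.
Variable R : realType.
Implicit Types z w : R[i].

Lemma ReM z w :
  complex.Re (z * w) = complex.Re z * complex.Re w - complex.Im z * complex.Im w.
Proof. by case: z w => [a b] [c d]. Qed.

Lemma ImM z w :
  complex.Im (z * w) = complex.Re z * complex.Im w + complex.Im z * complex.Re w.
Proof. by case: z w => [a b] [c d]. Qed.

Lemma ReD z w : complex.Re (z + w) = complex.Re z + complex.Re w.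
Proof. by case: z w => [a b] [c d]. Qed.

Lemma ImD z w : complex.Im (z + w) = complex.Im z + complex.Im w.
Proof. by case: z w => [a b] [c d]. Qed.

Lemma ReN z : complex.Re (- z) = - complex.Re z.
Proof. by case: z. Qed.

Lemma ImN z : complex.Im (- z) = - complex.Im z.
Proof. by case: z. Qed.

Lemma ReJ z : complex.Re (Num.conj z) = complex.Re z.
Proof. by case: z. Qed.

Lemma ImJ z : complex.Im (Num.conj z) = - complex.Im z.
Proof. by case: z. Qed.

Lemma complex_parts z w :
  complex.Re z = complex.Re w -> complex.Im z = complex.Im w -> z = w.
Proof. by case: z w => [a b] [c d] /= -> ->. Qed.

Lemma Re_sum (I : Type) (r : seq I) (P : pred I) (F : I -> R[i]) :
  complex.Re (\sum_(i <- r | P i) F i) = \sum_(i <- r | P i) complex.Re (F i).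
Proof. by apply: (big_morph (@complex.Re R)) => // z w; rewrite ReD. Qed.

Lemma sqr_norm_parts z :
  complex.Re z ^+ 2 + complex.Im z ^+ 2 = complex.Re (z * Num.conj z).
Proof. by case: z => a b /=; ring. Qed.

End ComplexParts.

Section ComplexDerivative.
Variable R : realType.
Implicit Types (c e : R -> R[i]) (t : R) (z w : R[i]).

(** Chosen so that [is_derive_mx F t D] applied to [i] and [j] is by conversion a derivative of this
    kind; the matrix rules then follow from the scalar ones. *)
Definition is_derive_C c t z :=
  is_derive t 1 (fun s => complex.Re (c s)) (complex.Re z) /\
  is_derive t 1 (fun s => complex.Im (c s)) (complex.Im z).

Lemma is_derive_C_cst z t : is_derive_C (cst z) t 0.
Proof. by split; apply: is_derive_cst. Qed.

Lemma is_derive_C_real (f : R -> R) t (d : R) :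
  is_derive t 1 f d -> is_derive_C (fun s => (f s)%:C) t d%:C.
Proof. by move=> fd; split => //; apply: is_derive_cst. Qed.

Lemma is_derive_CD c e t z w :
  is_derive_C c t z -> is_derive_C e t w -> is_derive_C (c \+ e) t (z + w).
Proof.
move=> [c1 c2] [e1 e2]; split.
  rewrite ReD (_ : (fun s => _) = (fun s => complex.Re (c s)) + (fun s => complex.Re (e s))).
    exact: is_deriveD.
  by apply/funext => s /=; rewrite ReD.
rewrite ImD (_ : (fun s => _) = (fun s => complex.Im (c s)) + (fun s => complex.Im (e s))).
  exact: is_deriveD.
by apply/funext => s /=; rewrite ImD.
Qed.

Lemma is_derive_CJ c t z :
  is_derive_C c t z -> is_derive_C (fun s => Num.conj (c s)) t (Num.conj z).
Proof.
move=> [c1 c2]; split.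
  rewrite ReJ (_ : (fun s => _) = (fun s => complex.Re (c s))) //.
  by apply/funext => s; rewrite ReJ.
rewrite ImJ (_ : (fun s => _) = - (fun s => complex.Im (c s))).
  exact: is_deriveN.
by apply/funext => s; rewrite ImJ.
Qed.

Lemma is_derive_CM c e t z w :
  is_derive_C c t z -> is_derive_C e t w ->
  is_derive_C (fun s => c s * e s) t (z * e t + c t * w).
Proof.
move=> [c1 c2] [e1 e2]; split.
  rewrite (_ : (fun s => _) =
    (fun s => complex.Re (c s)) * (fun s => complex.Re (e s))
    - (fun s => complex.Im (c s)) * (fun s => complex.Im (e s))); last first.
    by apply/funext => s; rewrite ReM.
  by apply: is_derive_eq; rewrite /GRing.scale /= ReD !ReM; ring.
rewrite (_ : (fun s => _) =
    (fun s => complex.Re (c s)) * (fun s => complex.Im (e s))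
    + (fun s => complex.Im (c s)) * (fun s => complex.Re (e s))); last first.
  by apply/funext => s; rewrite ImM.
by apply: is_derive_eq; rewrite /GRing.scale /= ImD !ImM; ring.
Qed.

Lemma is_derive_C_sum (I : Type) (r : seq I) (c : I -> R -> R[i]) t (z : I -> R[i]) :
  (forall i, is_derive_C (c i) t (z i)) ->
  is_derive_C (fun s => \sum_(i <- r) c i s) t (\sum_(i <- r) z i).
Proof.
move=> cz; elim: r => [|i r IH].
  rewrite big_nil (_ : (fun s => _) = cst 0); first exact: is_derive_C_cst.
  by apply/funext => s; rewrite big_nil.
rewrite big_cons (_ : (fun s => _) = c i \+ (fun s => \sum_(j <- r) c j s)).
  exact: is_derive_CD.
by apply/funext => s; rewrite big_cons.
Qed.

(** The differentiated factor is left out by its index, so a repeated index would lose all its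
    occurrences at once; hence [uniq r]. *)
Lemma is_derive_C_prod (I : eqType) (r : seq I) (c : I -> R -> R[i]) t (z : I -> R[i]) :
  uniq r -> (forall i, is_derive_C (c i) t (z i)) ->
  is_derive_C (fun s => \prod_(i <- r) c i s) t
    (\sum_(i <- r) z i * \prod_(j <- r | j != i) c j t).
Proof.
move=> + cz; elim: r => [|i r IH] /=.
  rewrite big_nil (_ : (fun s => _) = cst 1); first by move=> _; exact: is_derive_C_cst.
  by apply/funext => s; rewrite big_nil.
case/andP => ir /IH{}IH; rewrite big_cons.
rewrite (_ : (fun s => _) = (fun s => c i s * \prod_(j <- r) c j s)); last first.
  by apply/funext => s; rewrite big_cons.
have := is_derive_CM (cz i) IH; congr (is_derive_C _ _ (_ + _)).
  rewrite big_cons eqxx /=; congr (_ * _); rewrite big_seq [RHS]big_seq_cond.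
  apply: eq_bigl => j; case: eqVneq => [->|_]; last by rewrite andbT.
  by rewrite (negPf ir).
rewrite mulr_sumr; apply: eq_big_seq => j jr.
rewrite big_cons; case: (eqVneq i j) => [ij|_] /=; last exact: mulrCA.
by rewrite ij jr in ir.
Qed.

Lemma derive_C_val c t z : is_derive_C c t z ->
  derive1 (fun s => complex.Re (c s)) t +i* derive1 (fun s => complex.Im (c s)) t = z.
Proof.
move=> [c1 c2]; apply: complex_parts => /=; rewrite derive1E derive_val //.
Qed.

Lemma is_derive_C_eq0 c : (forall t, is_derive_C c t 0) -> forall s t, c s = c t.
Proof.
move=> c0 s t; apply: complex_parts.
  by apply: (@is_derive_0_is_cst _ (fun s => complex.Re (c s))) => x; case: (c0 x).
by apply: (@is_derive_0_is_cst _ (fun s => complex.Im (c s))) => x; case: (c0 x).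
Qed.

End ComplexDerivative.

(** * Bounded complex-valued families *)

Section ComplexBounded.
Variables (R : realType) (T : Type).
Implicit Types c e : T -> R[i].

Definition bounded_C c := exists K : R, forall t, `|c t| <= K%:C.

Lemma bounded_C_cst (z : R[i]) : bounded_C (cst z).
Proof. by exists (complex.Re `|z|) => t; rewrite RRe_real // normr_real. Qed.

Lemma bounded_CD c e : bounded_C c -> bounded_C e -> bounded_C (c \+ e).
Proof.
move=> [K cK] [L eL]; exists (K + L) => t.
by rewrite rmorphD /= (le_trans (ler_normD _ _)) // lerD.
Qed.

Lemma bounded_CM c e : bounded_C c -> bounded_C e -> bounded_C (fun t => c t * e t).
Proof.
move=> [K cK] [L eL]; exists (K * L) => t.
by rewrite rmorphM /= normrM ler_pM.
Qed.

Lemma bounded_CJ c : bounded_C c -> bounded_C (fun t => Num.conj (c t)).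
Proof. by move=> [K cK]; exists K => t; rewrite norm_conjC. Qed.

Lemma bounded_C_sum (I : Type) (r : seq I) (c : I -> T -> R[i]) :
  (forall i, bounded_C (c i)) -> bounded_C (fun t => \sum_(i <- r) c i t).
Proof.
move=> cb; elim: r => [|i r IH].
  by rewrite (_ : (fun t => _) = cst 0);
    [exact: bounded_C_cst|apply/funext => t; rewrite big_nil].
rewrite (_ : (fun t => _) = c i \+ (fun t => \sum_(j <- r) c j t)).
  exact: bounded_CD.
by apply/funext => t; rewrite big_cons.
Qed.

Lemma bounded_C_real (f : T -> R) (K : R) :
  (forall t, `|f t| <= K) -> bounded_C (fun t => (f t)%:C).
Proof.
move=> fK; exists K => t; rewrite normc_def /= expr0n addr0 sqrtr_sqr lecR //.
Qed.

Lemma bounded_C_Re c : bounded_C c -> exists K, forall t, `|complex.Re (c t)| <= K.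
Proof.
by move=> [K cK]; exists K => t; rewrite -lecR (le_trans (normc_ge_Re _)).
Qed.

End ComplexBounded.

(** * Limits of complex-valued families along a filter *)

Section ComplexLimit.
Variables (R : realType) (T : Type) (F : set_system T).
Hypothesis FF : Filter F.
Implicit Types c e : T -> R[i].

Definition cvg_C c (z : R[i]) :=
  (complex.Re (c t) @[t --> F] --> complex.Re z) /\
  (complex.Im (c t) @[t --> F] --> complex.Im z).

Lemma cvg_C_cst z : cvg_C (cst z) z.
Proof. by split; apply: cvg_cst. Qed.

Lemma cvg_CD c e z w : cvg_C c z -> cvg_C e w -> cvg_C (c \+ e) (z + w).
Proof.
move=> [c1 c2] [e1 e2]; split.
  by rewrite ReD; under eq_fun do rewrite ReD; apply: cvgD.
by rewrite ImD; under eq_fun do rewrite ImD; apply: cvgD.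
Qed.

Lemma cvg_CM c e z w : cvg_C c z -> cvg_C e w -> cvg_C (fun t => c t * e t) (z * w).
Proof.
move=> [c1 c2] [e1 e2]; split.
  by rewrite ReM; under eq_fun do rewrite ReM; apply: cvgB; apply: cvgM.
by rewrite ImM; under eq_fun do rewrite ImM; apply: cvgD; apply: cvgM.
Qed.

Lemma cvg_CJ c z : cvg_C c z -> cvg_C (fun t => Num.conj (c t)) (Num.conj z).
Proof.
move=> [c1 c2]; split.
  by rewrite ReJ; under eq_fun do rewrite ReJ.
by rewrite ImJ; under eq_fun do rewrite ImJ; apply: cvgN.
Qed.

Lemma cvg_C_sum (I : Type) (r : seq I) (c : I -> T -> R[i]) (z : I -> R[i]) :
  (forall i, cvg_C (c i) (z i)) ->
  cvg_C (fun t => \sum_(i <- r) c i t) (\sum_(i <- r) z i).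
Proof.
move=> cz; elim: r => [|i r IH].
  rewrite (_ : (fun t => _) = cst 0); first by rewrite big_nil; exact: cvg_C_cst.
  by apply/funext => t; rewrite big_nil.
rewrite (_ : (fun t => _) = c i \+ (fun t => \sum_(j <- r) c j t)).
  by rewrite big_cons; exact: cvg_CD.
by apply/funext => t; rewrite big_cons.
Qed.

Lemma cvg_C_prod (I : Type) (r : seq I) (c : I -> T -> R[i]) (z : I -> R[i]) :
  (forall i, cvg_C (c i) (z i)) ->
  cvg_C (fun t => \prod_(i <- r) c i t) (\prod_(i <- r) z i).
Proof.
move=> cz; elim: r => [|i r IH].
  rewrite (_ : (fun t => _) = cst 1); first by rewrite big_nil; exact: cvg_C_cst.
  by apply/funext => t; rewrite big_nil.
rewrite (_ : (fun t => _) = (fun t => c i t * \prod_(j <- r) c j t)).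
  by rewrite big_cons; exact: cvg_CM.
by apply/funext => t; rewrite big_cons.
Qed.

End ComplexLimit.

Lemma cvg_C_unique (R : realType) (T : Type) (F : set_system T) (FF : ProperFilter F)
  (c : T -> R[i]) (z w : R[i]) : cvg_C F c z -> cvg_C F c w -> z = w.
Proof.
move=> [c1 c2] [d1 d2].
by apply: complex_parts; [exact: cvg_unique c1 d1|exact: cvg_unique c2 d2].
Qed.

(** The image filter contains a compact segment, hence clusters there, and a cluster point of an
    ultrafilter is a limit. *)
Lemma bounded_cvg_ultra (R : realType) (T : Type) (F : set_system T)
  (FU : UltraFilter F) (f : T -> R) (K : R) :
  (forall t, `|f t| <= K) -> exists l : R, f @ F --> l.
Proof.
move=> fK.
have fF : F (f @^-1` `[- K, K]%classic).
  by apply: filterE => t; rewrite /= in_itv /=; have := fK t; rewrite ler_norml.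
have [l [_ fl]] := @segment_compact R (- K) K (f @ F) _ fF.
exists l => A Al; have [//|FnA] := in_ultra_setVsetC (f @^-1` A) FU.
by have [x [nAx /nAx]] := fl (~` A) A FnA Al.
Qed.

Lemma bounded_C_cvg_ultra (R : realType) (T : Type) (F : set_system T)
  (FU : UltraFilter F) (c : T -> R[i]) : bounded_C c -> exists z, cvg_C F c z.
Proof.
move=> cb; have [K /(bounded_cvg_ultra FU)[l cl]] := bounded_C_Re cb.
(* The real part of i c is minus the imaginary part of c, so the real case also yields the imaginary
   limit, up to sign. *)
have /bounded_C_Re[L] : bounded_C (fun t => 'i%C * c t).
  by apply: bounded_CM => //; exact: bounded_C_cst.
move=> /(bounded_cvg_ultra FU)[m cm]; exists (l +i* (- m)); split => //=.
have -> : (fun t => complex.Im (c t)) = (fun t => - complex.Re ('i%C * c t)).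
  by apply/funext => t; rewrite ReM /= mul0r mul1r sub0r opprK.
exact: cvgN.
Qed.

(** * Matrix curves *)

Section MatrixDerivative.
Variables (R : realType) (n : nat).
Implicit Types (F E : R -> 'M[R[i]]_n) (A B D : 'M[R[i]]_n) (t : R).

Lemma is_derive_mx_eq F t A B : is_derive_mx F t A -> A = B -> is_derive_mx F t B.
Proof. by move=> + <-. Qed.

Lemma is_derive_mx_cst A t : is_derive_mx (cst A) t 0.
Proof. by move=> i j; rewrite mxE; apply: is_derive_C_cst. Qed.

Lemma is_derive_mxM F E t A B :
  is_derive_mx F t A -> is_derive_mx E t B ->
  is_derive_mx (fun s => F s *m E s) t (A *m E t + F t *m B).
Proof.
move=> FA EB i j; rewrite !mxE -big_split /=.
have := is_derive_C_sum (index_enum 'I_n) (fun k => is_derive_CM (FA i k) (EB k j)).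
by congr (is_derive_C _ _ _); apply/funext => s /=; rewrite mxE.
Qed.

Lemma is_derive_mxJ F t A :
  is_derive_mx F t A -> is_derive_mx (fun s => (F s)^t*) t (A^t*).
Proof.
move=> FA i j; rewrite !mxE; have := is_derive_CJ (FA j i).
by congr (is_derive_C _ _ _); apply/funext => s /=; rewrite !mxE.
Qed.

Lemma is_derive_V F t A : is_derive_mx F t A -> is_derive t 1 (fun s => V (F s)) (V A).
Proof.
by move=> FA; case: (is_derive_C_sum (index_enum 'I_n) (fun k => FA k k)).
Qed.

Lemma derive_mx_val F t A : is_derive_mx F t A -> Defs.derive_mx F t = A.
Proof.
by move=> FA; apply/matrixP => i j; rewrite !mxE; exact: (derive_C_val (c := fun s => F s i j) (FA i j)).
Qed.

Lemma is_derive_mx_eq0 F : (forall t, is_derive_mx F t 0) -> forall s t, F s = F t.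
Proof.
move=> F0 s t; apply/matrixP => i j.
apply: (is_derive_C_eq0 (c := fun s => F s i j)) => {}t.
by have := F0 t i j; rewrite mxE.
Qed.

(* Jacobi's formula *)
Lemma is_derive_det F t A : is_derive_mx F t A ->
  is_derive_C (fun s => \det (F s)) t (\tr (A *m \adj (F t))).
Proof.
move=> FA; pose S := index_enum {perm 'I_n}.
have /= := is_derive_C_sum S (fun s : {perm 'I_n} => is_derive_CM
  (is_derive_C_cst ((-1) ^+ s) t)
  (is_derive_C_prod (index_enum_uniq 'I_n) (fun i => FA i (s i)))).
congr (is_derive_C _ _ _).
(* The product rule gives the sum over [i] of the determinants in which only row [i] is
   differentiated. Expanding along that row leaves cofactors of [F t] itself, whence the
   adjugate. *)
pose row_repl i := \matrix_(k, j) (if k == i then A i j else F t k j).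
transitivity (\sum_i \det (row_repl i)).
  rewrite /determinant [RHS]exchange_big /=; apply: eq_bigr => s _.
  rewrite mul0r add0r mulr_sumr; apply: eq_bigr => i _; congr (_ * _).
  rewrite [RHS](bigD1 i) //=  !mxE eqxx; congr (_ * _).
  by apply: eq_bigr => k ki; rewrite mxE (negPf ki).
rewrite /mxtrace; apply: eq_bigr => i _; rewrite (expand_det_row _ i) !mxE.
apply: eq_bigr => j _; rewrite !mxE eqxx; congr (_ * (_ * \det _)).
by apply/matrixP => k l; rewrite !mxE eq_sym (negPf (neq_lift _ _)).
Qed.

(** * Algebra of V, the adjoint and unitary matrices *)

Lemma V_D A B : V (A + B) = V A + V B.
Proof. by rewrite /V mxtraceD ReD. Qed.

Lemma V_N A : V (- A) = - V A.
Proof. by rewrite /V raddfN /= ReN. Qed.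

Lemma V_0 : V (0 : 'M[R[i]]_n) = 0.
Proof. by rewrite /V mxtrace0. Qed.

Lemma V_Z (a : R) A : V (a%:C *: A) = a * V A.
Proof. by rewrite /V mxtraceZ ReM /= mul0r subr0. Qed.

Lemma V_sum (I : Type) (r : seq I) (A : I -> 'M[R[i]]_n) :
  V (\sum_(k <- r) A k) = \sum_(k <- r) V (A k).
Proof. by apply: (big_morph (@V R n)) => [A' B|]; [exact: V_D|exact: V_0]. Qed.

Lemma V_J A : V (A^t*) = V A.
Proof.
by rewrite /V /mxtrace !Re_sum; apply: eq_bigr => i _; rewrite !mxE ReJ.
Qed.

Lemma V_MC A B : V (A *m B) = V (B *m A).
Proof. by rewrite /V mxtrace_mulC. Qed.

Lemma adjmxM A B : (A *m B)^t* = B^t* *m A^t*.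
Proof. by rewrite trmx_mul map_mxM. Qed.

Lemma adjmxD A B : (A + B)^t* = A^t* + B^t*.
Proof. by apply/matrixP => i j; rewrite !mxE rmorphD. Qed.

Lemma adjmxN A : (- A)^t* = - A^t*.
Proof. by apply/matrixP => i j; rewrite !mxE rmorphN. Qed.

Lemma adjmx_sum (I : Type) (r : seq I) (A : I -> 'M[R[i]]_n) :
  (\sum_(k <- r) A k)^t* = \sum_(k <- r) (A k)^t*.
Proof.
apply: (big_morph (fun A : 'M[R[i]]_n => A ^t*)) => [A' B|]; first exact: adjmxD.
by apply/matrixP => i j; rewrite !mxE rmorph0.
Qed.

Lemma adjmxZ (a : R) A : (a%:C *: A)^t* = a%:C *: A^t*.
Proof.
apply/matrixP => i j; rewrite !mxE rmorphM /=; congr (_ * _).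
by apply: complex_parts; rewrite ?ReJ ?ImJ //= oppr0.
Qed.

Lemma unitarymxPl A : A^t* *m A = 1%:M <-> A \is unitarymx.
Proof. by split=> [/mulmx1C/unitarymxP//|/unitarymxP/mulmx1C]. Qed.

Lemma mx_norm2 A : \sum_i \sum_j (complex.Re (A i j) ^+ 2 + complex.Im (A i j) ^+ 2)
  = V (A *m A^t*).
Proof.
rewrite /V /mxtrace Re_sum; apply: eq_bigr => i _.
rewrite mxE Re_sum; apply: eq_bigr => j _.
by rewrite sqr_norm_parts !mxE.
Qed.

(** The diagonal entries of A A^* are the squared lengths of the rows of A, here equal to 1. *)
Lemma unitary_entry_le1 A i j : A \is unitarymx ->
  complex.Re (A i j) ^+ 2 + complex.Im (A i j) ^+ 2 <= 1.
Proof.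
move=> /unitarymxP/matrixP/(_ i i)/(congr1 (@complex.Re R)).
rewrite mxE Re_sum !mxE eqxx /= => <-.
rewrite (bigD1 j) //= sqr_norm_parts !mxE lerDl sumr_ge0 // => k _.
by rewrite !mxE -sqr_norm_parts addr_ge0 // sqr_ge0.
Qed.

Lemma unitary_V_le A : A \is unitarymx -> V A <= n%:R.
Proof.
move=> Au; rewrite /V /mxtrace Re_sum -[n in n%:R]card_ord -sum1_card natr_sum.
apply: ler_sum => i _; have := unitary_entry_le1 i i Au => h.
rewrite real_leNgt ?num_real //; apply/negP => h1.
have := sqr_ge0 (complex.Im (A i i)); nra.
Qed.

Lemma unitary_sub1_norm A : A \is unitarymx ->
  euclidean_norm (A - 1%:M) = Num.sqrt (2 * (n%:R - V A)).
Proof.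
move=> /unitarymxP Au; rewrite /euclidean_norm mx_norm2 adjmxD adjmxN trmx1 map_mx1.
rewrite mulmxDl !mulmxDr Au !(mulNmx, mulmxN, mul1mx, mulmx1) opprK.
rewrite !(V_D, V_N, V_J) /V mxtrace1.
have -> : complex.Re (n%:R : R[i]) = n%:R.
  by rewrite -(rmorph_nat (real_complex R)).
by congr Num.sqrt; ring.
Qed.

Lemma su_conj A U : U \is unitarymx -> su R n A -> su R n (U^t* *m A *m U).
Proof.
move=> Uu [AJ Atr]; split.
  by rewrite !adjmxM trmxCK AJ mulNmx mulmxN mulmxA.
by rewrite mxtrace_mulC mulmxA (unitarymxP Uu) mul1mx.
Qed.

End MatrixDerivative.

(** * Asymptotics *)

Section RealAsymptotics.
Variable R : realType.
Implicit Types f g : R -> R.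

(** Locating [c] by distance instead of order allows shifts of either sign, and endpoints that come
    from an earlier mean value and are known only up to distance. *)
Lemma MVT_unordered f (df : R -> R) (a b : R) : (forall t : R, is_derive t 1 f (df t)) ->
  exists2 c, `|c - a| <= `|b - a| & f b - f a = df c * (b - a).
Proof.
move=> fd.
have fc x y : {within `[x, y], continuous f}.
  apply/continuous_subspaceT => r.
  exact/differentiable_continuous/derivable1_diffP.
have [ab|/ltW ba] := leP a b.
  have [c] := MVT_segment ab (fun x _ => fd x) (fc a b).
  rewrite in_itv /= => /andP[ac cb] E; exists c => //.
  by rewrite !ger0_norm ?subr_ge0 // lerD2r.
have [c] := MVT_segment ba (fun x _ => fd x) (fc b a).
rewrite in_itv /= => /andP[ac cb] E; exists c.
  by rewrite !ler0_norm ?subr_le0 // lerN2 lerD2r.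
by rewrite -opprB E; ring.
Qed.

Lemma nondecreasing_bounded_cvg f (M : R) :
  (forall s t, s <= t -> f s <= f t) -> (forall t, f t <= M) ->
  exists2 l, f t @[t --> +oo] --> l & forall t, f t <= l.
Proof.
move=> fnd fM; have ub : has_ubound (range f) by exists M => _ [t _ <-].
exists (sup (range f)); first exact: nondecreasing_cvgr.
by move=> t; apply: ub_le_sup => //; exists t.
Qed.

(** If |g t| >= e at a late time, the bound on [dg] keeps |g| >= e/2 within distance [h] of [t], so
    [v] gains at least [eta] between [t] and [t + h]. This is impossible once [v t] is within [eta]
    of its limit, which bounds [v] from above. *)
Lemma barbalat v dv g dg (a K M : R) : 0 < a ->
  (forall t : R, is_derive t 1 v (dv t)) -> (forall t : R, is_derive t 1 g (dg t)) ->
  (forall t, a * g t ^+ 2 <= dv t) -> (forall t, `|dg t| <= K) ->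
  (forall t, v t <= M) -> g t @[t --> +oo] --> 0.
Proof.
move=> a0 vd gd gv gK vM.
have dv0 t : 0 <= dv t by apply: le_trans (gv t); rewrite mulr_ge0 ?sqr_ge0 // ltW.
have vnd s t : s <= t -> v s <= v t.
  move=> st; have [c _ E] := MVT_unordered s t vd.
  by rewrite -subr_ge0 E mulr_ge0 // subr_ge0.
have [l vl vlel] := nondecreasing_bounded_cvg vnd vM.
(* A strictly positive bound on [dg], since [h] is obtained by dividing by it. *)
pose K1 := `|K| + 1.
have K10 : 0 < K1 by rewrite ltr_wpDl.
have gK1 t : `|dg t| <= K1.
  by rewrite (le_trans (gK t)) // (le_trans (ler_norm K)) // lerDl.
apply/cvgr0Pnorm_lt => e e0.
pose h := e / 2 / K1.
have h0 : 0 < h by rewrite !divr_gt0.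
pose eta := a * (e / 2) ^+ 2 * h.
have eta0 : 0 < eta by apply: mulr_gt0 => //; apply: mulr_gt0 => //; apply: exprn_gt0; apply: divr_gt0.
move/cvgrPdist_lt: vl => /(_ eta eta0); apply: filterS => t.
rewrite ger0_norm ?subr_ge0 // => lt.
rewrite ltNge; apply/negP => eg.
have [c cth E] := MVT_unordered t (t + h) vd.
move: cth; rewrite addrAC subrr add0r (ger0_norm (ltW h0)) => cth.
have [c' _ E'] := MVT_unordered t c gd.
have : `|g c - g t| <= e / 2.
  rewrite E' normrM (_ : e / 2 = K1 * h); last by rewrite /h; field; rewrite gt_eqF.
  by rewrite ler_pM.
move=> gct.
have gc : e / 2 <= `|g c|.
  have := ler_normB (g c) (g c - g t); rewrite subKr => hh.
  have := le_trans eg hh; lra.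
have : (e / 2) ^+ 2 <= g c ^+ 2.
  by rewrite -[g c ^+ 2]real_normK ?num_real // ler_pXn2r // nnegrE ?divr_ge0 // ltW.
move=> gc2.
have : eta <= dv c * h.
  by rewrite ler_pM2r // (le_trans _ (gv c)) // ler_pM2l.
have := vlel (t + h); move: E; rewrite addrAC subrr add0r => E.
lra.
Qed.

Lemma cvg0_mul_bounded (T : Type) (F : set_system T) (FF : Filter F) (f g : T -> R) (K : R) :
  f t @[t --> F] --> 0 -> (forall t, `|g t| <= K) -> f t * g t @[t --> F] --> 0.
Proof.
move=> /cvgr0Pnorm_lt f0 gK; apply/cvgr0Pnorm_lt => e e0.
have K10 : 0 < `|K| + 1 by rewrite ltr_wpDl.
have /f0 : 0 < e / (`|K| + 1) by rewrite divr_gt0.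
apply: filterS => t ft; rewrite normrM.
have : `|g t| <= `|K| + 1.
  by rewrite (le_trans (gK t)) // (le_trans (ler_norm K)) // lerDl.
move=> gt; apply: le_lt_trans (_ : `|f t| * (`|K| + 1) < e); first by rewrite ler_wpM2l.
by rewrite -ltr_pdivlMr.
Qed.

(** Used to pass from the samples at jT to those at s + jT: by the mean value theorem the increment
    is [s] times a late value of [df]. *)
Lemma cvg_shift_of_derive0 f df (s : R) : (forall t : R, is_derive t 1 f (df t)) ->
  df t @[t --> +oo] --> 0 -> f (t + s) - f t @[t --> +oo] --> 0.
Proof.
move=> fd /cvgr0Pnorm_lt df0; apply/cvgr0Pnorm_lt => e e0.
have s0 : 0 < `|s| + 1 by rewrite ltr_wpDl.
have /df0[M [Mr HM]] : 0 < e / (`|s| + 1) by rewrite divr_gt0.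
(* The mean value point may lie up to |s| before [t]; the margin keeps it beyond [M]. *)
exists (M + `|s|); split; first exact: num_real.
move=> t Mt; have [c cs ->] := MVT_unordered t (t + s) fd.
move: cs; rewrite addrAC subrr add0r => cs.
have : M < c by move: cs; rewrite ler_norml => /andP[h _]; lra.
move=> /HM dfc; rewrite normrM; apply: le_lt_trans (_ : `|df c| * (`|s| + 1) < e).
  by rewrite ler_wpM2l // lerDl.
by rewrite -ltr_pdivlMr.
Qed.

End RealAsymptotics.

(** * Bounded families of matrices and their limits along a filter *)

Section MatrixCurves.
Variables (R : realType) (n : nat).

Definition bounded_mx (T : Type) (A : T -> 'M[R[i]]_n) :=
  forall i j, bounded_C (fun t => A t i j).

Definition limit_mx (T : Type) (F : set_system T) (A : T -> 'M[R[i]]_n) (L : 'M[R[i]]_n) :=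
  forall i j, cvg_C F (fun t => A t i j) (L i j).

Section Closure.
Variables (T : Type).
Implicit Types A B : T -> 'M[R[i]]_n.

Lemma bounded_mx_cst (M : 'M[R[i]]_n) : bounded_mx (fun _ : T => M).
Proof. by move=> i j; apply: bounded_C_cst. Qed.

Lemma bounded_mxD A B : bounded_mx A -> bounded_mx B -> bounded_mx (fun t => A t + B t).
Proof.
move=> Ab Bb i j; have := bounded_CD (Ab i j) (Bb i j); congr bounded_C.
by apply/funext => t /=; rewrite mxE.
Qed.

Lemma bounded_mxM A B : bounded_mx A -> bounded_mx B -> bounded_mx (fun t => A t *m B t).
Proof.
move=> Ab Bb i j.
have := bounded_C_sum (index_enum 'I_n) (fun k => bounded_CM (Ab i k) (Bb k j)).
by congr bounded_C; apply/funext => t /=; rewrite mxE.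
Qed.

Lemma bounded_mxJ A : bounded_mx A -> bounded_mx (fun t => (A t)^t*).
Proof.
move=> Ab i j; have := bounded_CJ (Ab j i); congr bounded_C.
by apply/funext => t /=; rewrite !mxE.
Qed.

Lemma bounded_mxZ (a : T -> R) (K : R) A : (forall t, `|a t| <= K) ->
  bounded_mx A -> bounded_mx (fun t => (a t)%:C *: A t).
Proof.
move=> aK Ab i j; have := bounded_CM (bounded_C_real aK) (Ab i j); congr bounded_C.
by apply/funext => t /=; rewrite !mxE.
Qed.

Lemma bounded_mx_sum (I : Type) (r : seq I) (A : I -> T -> 'M[R[i]]_n) :
  (forall k, bounded_mx (A k)) -> bounded_mx (fun t => \sum_(k <- r) A k t).
Proof.
move=> Ab i j; have := bounded_C_sum r (fun k => Ab k i j); congr bounded_C.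
by apply/funext => t /=; rewrite summxE.
Qed.

Lemma bounded_mx_unitary A : (forall t, A t \is unitarymx) -> bounded_mx A.
Proof.
move=> Au i j; exists 1 => t; have := unitary_entry_le1 i j (Au t).
by rewrite normc_def lecR -{2}sqrtr1 => h; rewrite ler_wsqrtr.
Qed.

Lemma bounded_V A : bounded_mx A -> exists K, forall t, `|V (A t)| <= K.
Proof.
by move=> Ab; apply: bounded_C_Re; apply: (bounded_C_sum _ (fun k => Ab k k)).
Qed.

Variables (F : set_system T) (FF : Filter F).

Lemma limit_mx_cst (M : 'M[R[i]]_n) : limit_mx F (fun _ : T => M) M.
Proof. by move=> i j; apply: cvg_C_cst. Qed.

Lemma limit_mxM A B (L M : 'M[R[i]]_n) :
  limit_mx F A L -> limit_mx F B M -> limit_mx F (fun t => A t *m B t) (L *m M).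
Proof.
move=> AL BM i j; rewrite mxE.
have := cvg_C_sum FF (index_enum 'I_n) (fun k => cvg_CM FF (AL i k) (BM k j)).
by congr cvg_C; apply/funext => t /=; rewrite mxE.
Qed.

Lemma limit_mxJ A (L : 'M[R[i]]_n) :
  limit_mx F A L -> limit_mx F (fun t => (A t)^t*) (L^t*).
Proof.
move=> AL i j; rewrite !mxE; have := cvg_CJ FF (AL j i).
by congr cvg_C; apply/funext => t /=; rewrite !mxE.
Qed.

Lemma limit_V A (L : 'M[R[i]]_n) : limit_mx F A L -> V (A t) @[t --> F] --> V L.
Proof. by move=> AL; case: (cvg_C_sum FF (index_enum 'I_n) (fun k => AL k k)). Qed.

Lemma limit_det A (L : 'M[R[i]]_n) : limit_mx F A L -> cvg_C F (fun t => \det (A t)) (\det L).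
Proof.
move=> AL; apply: (cvg_C_sum FF) => s; apply: (cvg_CM FF); first exact: cvg_C_cst.
by apply: (cvg_C_prod FF) => i; apply: AL.
Qed.

End Closure.

Lemma limit_mx_unique (T : Type) (F : set_system T) (FF : ProperFilter F)
    (A : T -> 'M[R[i]]_n) (L M : 'M[R[i]]_n) :
  limit_mx F A L -> limit_mx F A M -> L = M.
Proof.
by move=> AL AM; apply/matrixP => i j; apply: (cvg_C_unique FF (AL i j) (AM i j)).
Qed.

Lemma bounded_mx_limit_ultra (T : Type) (F : set_system T) (FU : UltraFilter F)
    (A : T -> 'M[R[i]]_n) : bounded_mx A -> exists L, limit_mx F A L.
Proof.
move=> Ab; have /choice[L AL] (p : 'I_n * 'I_n) : exists z, cvg_C F (fun t => A t p.1 p.2) z.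
  exact: bounded_C_cvg_ultra.
by exists (\matrix_(i, j) L (i, j)) => i j; rewrite mxE; exact: AL (i, j).
Qed.

Lemma limit_SU (T : Type) (F : set_system T) (FF : ProperFilter F)
    (A : T -> 'M[R[i]]_n) (L : 'M[R[i]]_n) :
  (forall t, SU R n (A t)) -> limit_mx F A L -> SU R n L.
Proof.
move=> ASU AL; split.
  apply/unitarymxP; apply: (limit_mx_unique FF (limit_mxM FF AL (limit_mxJ FF AL))).
  rewrite (_ : (fun t => _) = (fun _ => 1%:M)); first exact: limit_mx_cst.
  by apply/funext => t; case: (ASU t) => /unitarymxP.
apply: (cvg_C_unique FF (limit_det FF AL)).
rewrite (_ : (fun t => _) = cst 1); first exact: cvg_C_cst.
by apply/funext => t; case: (ASU t).
Qed.

End MatrixCurves.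

Lemma cvg_C0_mul_bounded (R : realType) (T : Type) (F : set_system T) (FF : Filter F)
    (a : T -> R) (c : T -> R[i]) :
  a t @[t --> F] --> 0 -> bounded_C c -> cvg_C F (fun t => (a t)%:C * c t) 0.
Proof.
move=> a0 cb; split.
  have [K cK] := bounded_C_Re cb; under eq_fun do rewrite ReM /= mul0r subr0.
  exact: cvg0_mul_bounded cK.
have [K cK] := bounded_C_Re (bounded_CM (bounded_C_cst T ('i%C : R[i])) cb).
have -> : (fun t => complex.Im ((a t)%:C * c t))
  = (fun t => - (a t * complex.Re ('i%C * c t))).
  by apply/funext => t; rewrite ImM ReM /=; ring.
by have := cvgN (cvg0_mul_bounded FF a0 cK); rewrite oppr0; exact.
Qed.

(** * Critical values of V *)

Section CriticalValues.
Variables (R : realType) (n : nat).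

Lemma finite_root (p : {poly R[i]}) : p != 0 -> finite_set [set z | root p z].
Proof.
move=> p0; have [r Ep] := closed_field_poly_normal p.
apply: (@sub_finite_set _ _ [set` r]); last exact: finite_seq.
by move=> z /=; rewrite Ep rootZ ?lead_coef_eq0 // root_prod_XsubC.
Qed.

Lemma finite_max (A : set R) : finite_set A -> A !=set0 -> exists m, is_max A m.
Proof.
move=> /finite_seqP[s ->] [x] /=.
elim: s x => [//|y s IH] x _.
have [->|[z zs]] : s = [::] \/ exists z, z \in s.
- by case: s {IH} => [|z s]; [left|right; exists z; rewrite mem_head].
- by exists y; split => [|z] /=; rewrite inE // => /eqP ->.
have [m [ms mub]] := IH z zs; have [ym|my] := leP y m.
  exists m; split => /= [|w]; first by rewrite inE (ms : m \in s) orbT.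
  by rewrite /= inE => /orP[/eqP->//|/mub].
exists y; split => /= [|w]; first by rewrite mem_head.
by rewrite /= inE => /orP[/eqP->//|/mub wm]; exact: le_trans (ltW my).
Qed.

Lemma Re_le_norm1 (z : R[i]) : `|z| = 1 -> complex.Re z <= 1.
Proof.
move=> z1; rewrite (le_trans (ler_norm _)) // -lecR.
by rewrite (le_trans (normc_ge_Re _)) // z1.
Qed.

Lemma norm1_parts (z : R[i]) : `|z| = 1 <-> complex.Re z ^+ 2 + complex.Im z ^+ 2 = 1.
Proof.
split=> [z1|z1]; last by rewrite normc_def z1 sqrtr1.
by have := add_Re2_Im2 z; rewrite z1 expr1n => /complexI.
Qed.

(* With common imaginary part b and a = sqrt (1 - b^2), every lambda_i is
   z = a + ib or -1/z; if they occur p and q times then z^(2p) = z^(2q) and the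
   sum of the real parts is (p - q) a. *)
Lemma G_sub (n0 : (0 < n)%N) : G R n `<=` [set 0] `|`
  \bigcup_(k in [set k : 'I_n.+1 * 'I_n.+1 | k.1 != k.2])
    [set complex.Re z *+ k.1 - complex.Re z *+ k.2 | z in
       [set z : R[i] | root ('X^(k.1.*2) - 'X^(k.2.*2)) z]].
Proof.
move=> x [l [-> l1 lprod lIm]].
pose b := complex.Im (l (Ordinal n0)); pose a := Num.sqrt (1 - b ^+ 2).
pose z : R[i] := a +i* b.
have lb i : complex.Im (l i) = b by exact: lIm.
have ab : a ^+ 2 = 1 - b ^+ 2.
  rewrite sqr_sqrtr // -(norm1_parts (l (Ordinal n0))).1 //.
  by rewrite addrK sqr_ge0.
have z1 : z * Num.conj z = 1.
  by rewrite -[LHS]/(_ +i* _); apply: complex_parts => /=; [move: ab => h; nra|ring].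
have z0 : z != 0 by apply: contra_eq_neq z1 => ->; rewrite mul0r eq_sym oner_neq0.
pose pl i := complex.Re (l i) == a.
have plE i : pl i -> l i = z by move=> /eqP h; apply: complex_parts => //=.
have npl i : ~~ pl i -> complex.Re (l i) = - a.
  rewrite /pl => h; have := (norm1_parts (l i)).1 (l1 i); rewrite lb => h2.
  have /eqP : complex.Re (l i) ^+ 2 = a ^+ 2 by rewrite ab -h2 addrK.
  by rewrite eqf_sqr (negPf h) => /eqP.
have nplE i : ~~ pl i -> l i = - z^-1.
  move=> /npl h; have -> : z^-1 = Num.conj z by apply: (mulfI z0); rewrite z1 divff.
  by apply: complex_parts; rewrite ?ReN ?ImN ?ReJ ?ImJ ?opprK.
pose p := #|pl|; pose q := #|predC pl|.
have pq : (p + q = n)%N by rewrite cardC card_ord.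
have -> : \sum_(i < n) complex.Re (l i) = a *+ p - a *+ q.
  rewrite (bigID pl) /= (eq_bigr (fun=> a)); last by move=> i /eqP.
  rewrite sumr_const; congr (_ + _).
  by rewrite (eq_bigr (fun=> - a)) // sumr_const mulNrn.
have zpq : z ^+ (p.*2) = z ^+ (q.*2).
  move: lprod; rewrite (bigID pl) /= (eq_bigr (fun=> z)); last by move=> i; exact: plE.
  rewrite prodr_const (eq_bigr (fun=> - z^-1)); last by move=> i; exact: nplE.
  (* Squaring removes the sign of (-1/z)^q. *)
  rewrite prodr_const -/p -/q => /(congr1 (fun w => w ^+ 2)).
  rewrite expr1n exprMn -!exprM !muln2.
  have -> : (- z^-1) ^+ q.*2 = (z ^+ q.*2)^-1.
    by rewrite -mul2n !exprM sqrrN !exprVn.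
  have zq0 : z ^+ q.*2 != 0 by rewrite expf_neq0.
  by move=> h; apply: (mulIf (invr_neq0 zq0)); rewrite h divff.
(* Equal multiplicities would make the polynomial zero and leave [z] unconstrained, but then the
   real parts add up to 0. *)
have [->|npq] := eqVneq p q; first by left; rewrite /= subrr.
have pn : (p < n.+1)%N by rewrite ltnS -pq leq_addr.
have qn : (q < n.+1)%N by rewrite ltnS -pq leq_addl.
right; exists (Ordinal pn, Ordinal qn) => //=.
by exists z => //=; rewrite /root !hornerE zpq subrr.
Qed.

Lemma G_finite : (0 < n)%N -> finite_set (G R n).
Proof.
move=> n0; apply: sub_finite_set (G_sub n0) _.
rewrite finite_setU; split; first exact: finite_set1.
apply: bigcup_finite => [|[k1 k2] /= k12]; first exact: finite_finset.
apply: finite_image; apply: finite_root.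
rewrite subr_eq0; apply: contra_neq k12 => /(congr1 (fun p : {poly R[i]} => size p)).
by rewrite !size_polyXn => -[] /double_inj /val_inj.
Qed.

Lemma G_n : G R n n%:R.
Proof.
exists (fun=> 1); split => //=.
- by rewrite sumr_const card_ord.
- by move=> i; rewrite normr1.
- by rewrite prodr_const expr1n.
Qed.

Lemma G_le (x : R) : G R n x -> x <= n%:R.
Proof.
move=> [l [-> l1 _ _]]; rewrite -[n in n%:R]card_ord -sum1_card natr_sum.
by apply: ler_sum => i _; exact: Re_le_norm1.
Qed.

(** Provides the nonemptiness from which [delta] is obtained. The entries -1 come in a pair so that
    the product stays 1, which is where n >= 2 enters. *)
Lemma G_nontrivial : (2 <= n)%N -> G R n `\ n%:R !=set0.
Proof.
move=> n2; pose l (i : 'I_n) : R[i] := if (i < 2)%N then -1 else 1.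
have n1 : (1 < n)%N by [].
have n0 : (0 < n)%N by exact: ltnW.
exists (\sum_i complex.Re (l i)); split.
  exists l; split => //.
  - by move=> i; rewrite /l; case: ifP; rewrite ?normrN normr1.
  - rewrite (bigD1 (Ordinal n0)) //= (bigD1 (Ordinal n1)) //= {1 2}/l /= big1.
      by rewrite mulr1 mulrNN mulr1.
    by case=> [[|[|k]]] //= kn; rewrite ?eqxx // /l.
  - by move=> i j; rewrite /l; do 2 case: ifP => _; rewrite /= ?oppr0.
apply/eqP; rewrite lt_eqF // -[n in n%:R]card_ord -sum1_card natr_sum.
rewrite (bigD1 (Ordinal n0)) //= [ltRHS](bigD1 (Ordinal n0)) //=.
apply: ltr_leD; first by rewrite /l /=; lra.
by apply: ler_sum => i _; rewrite /l; case: ifP => _ /=; lra.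
Qed.

Lemma critical_V_in_G (W : 'M[R[i]]_n) : (0 < n)%N -> SU R n W ->
  (forall Z, su R n Z -> V (W *m Z) = 0) -> G R n (V W).
Proof.
move=> n0 [Wu detW] crit.
have nz : (n%:R : R[i]) != 0 by rewrite pnatr_eq0 -lt0n.
(* [Z] is the orthogonal projection of [K] to su(n): as [K] is skew-Hermitian, [c] is purely
   imaginary, and subtracting it removes the trace without spoiling skewness. *)
pose K := W - W^t*; pose c := \tr K / n%:R; pose Z := K - c%:M.
have KJ : K^t* = - K by rewrite /K adjmxD adjmxN trmxCK opprB addrC.
have trJ (A : 'M[R[i]]_n) : \tr (A^t*) = Num.conj (\tr A).
  by rewrite /mxtrace rmorph_sum; apply: eq_bigr => i _; rewrite !mxE.
have cJ : Num.conj c = - c.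
  by rewrite /c rmorphM fmorphV rmorph_nat /= -trJ KJ raddfN mulNr.
have trZ : \tr Z = 0.
  by rewrite raddfB /= mxtrace_scalar /c -[(_ / _) *+ n]mulr_natr divfK // subrr.
have ZJ : Z^t* = - Z.
  rewrite /Z adjmxD adjmxN KJ tr_scalar_mx map_scalar_mx /= cJ.
  by apply/matrixP => i j; rewrite !mxE mulNrn opprK !opprB addrC.
have VJZ : V (W^t* *m Z) = 0.
  by rewrite -V_J adjmxM trmxCK ZJ mulNmx V_N V_MC crit // oppr0.
(* [Z] is orthogonal to [W], to the adjoint of [W] and, having trace 0, to the scalars. Being built
   from these three, it is orthogonal to itself. *)
have Z0 : Z = 0.
  have : V (Z *m Z^t*) = 0.
    rewrite ZJ mulmxN V_N {1}/Z mulmxBl mul_scalar_mx /K mulmxBl.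
    rewrite !(V_D, V_N) VJZ crit // /V mxtraceZ trZ mulr0 /=; ring.
  rewrite -mx_norm2 => /eqP.
  rewrite psumr_eq0 => [/allP h|i _]; last first.
    by apply: sumr_ge0 => j _; rewrite addr_ge0 ?sqr_ge0.
  apply/matrixP => i j; rewrite [RHS]mxE.
  have := h i (mem_index_enum _); rewrite psumr_eq0 => [/allP h'|k _]; last first.
    by rewrite addr_ge0 ?sqr_ge0.
  have := h' j (mem_index_enum _); rewrite paddr_eq0 ?sqr_ge0 // !sqrf_eq0.
  by move=> /andP[/eqP r0 /eqP i0]; apply: complex_parts.
(* A unitary matrix is normal, so the spectral theorem provides a unitary [P] diagonalizing [W]; the
   entries of [d] will be the witnesses for [G]. *)
have /orthomx_spectralP WE : W \is normalmx.
  by apply/normalmxP; rewrite (unitarymxP Wu) (unitarymxPl W).2.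
set P := spectralmx W in WE; set d := spectral_diag W in WE.
have Pu : P \is unitarymx by exact: spectral_unitarymx.
have DE : diag_mx d = P *m W *m P^t*.
  by rewrite WE invmx_unitary // !mulmxA (unitarymxP Pu) mul1mx -mulmxA (unitarymxP Pu) mulmx1.
have DJ : (diag_mx d)^t* = diag_mx (map_mx Num.conj d).
  by rewrite tr_diag_mx map_diag_mx.
have Du : diag_mx d \is unitarymx.
  by rewrite DE mul_unitarymx ?mul_unitarymx ?trmxC_unitary.
(* Conjugation by [P] fixes the scalar W - W^*, so each eigenvalue minus its conjugate equals the
   same [c]. *)
have Dc : diag_mx d - (diag_mx d)^t* = c%:M.
  have WWc : W - W^t* = c%:M by move/eqP: Z0; rewrite subr_eq0 => /eqP.
  rewrite DE !adjmxM trmxCK mulmxA -mulmxBl -mulmxBr WWc.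
  by rewrite mul_mx_scalar -scalemxAl (unitarymxP Pu) scalemx1.
exists (fun i => d 0 i); split.
- rewrite WE /V mxtrace_mulC mulmxA mulmxV ?unitarymx_unit // mul1mx.
  by rewrite mxtrace_diag Re_sum.
- move=> i; apply/norm1_parts; rewrite sqr_norm_parts.
  move/unitarymxP: Du => /matrixP/(_ i i); rewrite DJ mulmx_diag !mxE eqxx !mulr1n => ->.
  by [].
- have : \det P != 0 by rewrite -unitfE -unitmxE unitarymx_unit.
  move=> P0; move: detW; rewrite WE !det_mulmx det_inv det_diag mulrAC mulVf // mul1r.
  by [].
- move=> i j; have e k : complex.Im (d 0 k) = complex.Im c / 2.
    move/matrixP: Dc => /(_ k k); rewrite DJ !mxE eqxx !mulr1n => <-.
    by rewrite ImD ImN ImJ; field.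
  by rewrite !e.
Qed.

End CriticalValues.

(** * Trajectories of the auxiliary system *)

Section Trajectory.
Variables (R : realType) (n m : nat) (f : 'I_m -> R) (T : R).
Variables (S dS : 'I_m -> R -> 'M[R[i]]_n) (W : R -> 'M[R[i]]_n).
Hypothesis T0 : 0 < T.
Hypothesis f0 : forall k, f k != 0.
Hypothesis S_su : forall k t, su R n (S k t).
Hypothesis S_periodic : forall k, periodic (S k) T.
Hypothesis S_derive : forall k t, is_derive_mx (S k) t (dS k t).
Hypothesis S_bounded : forall k, bounded_mx (S k).
Hypothesis dS_bounded : forall k, bounded_mx (dS k).

(** [f k * g k t] is the feedback a_k along the trajectory, and [M] collects the right-hand side so
    that the equation reads W' = W M with [M] valued in su(n). *)
Let g k t := V (W t *m S k t).
Let M t : 'M[R[i]]_n := \sum_k (f k * (f k * g k t))%:C *: S k t.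

Hypothesis W_ode : forall t, is_derive_mx W t (W t *m M t).

Let M_su t : su R n (M t).
Proof.
split.
  rewrite adjmx_sum -sumrN; apply: eq_bigr => k _.
  by rewrite adjmxZ (S_su k t).1 scalerN.
rewrite /M raddf_sum big1 //= => k _.
by rewrite mxtraceZ (S_su k t).2 mulr0.
Qed.

(** Both W W^* and det W are constant: the first because [M] is skew-Hermitian, the second because
    by Jacobi's formula its derivative is det W times the trace of [M]. *)
Lemma trajectory_SU t0 : SU R n (W t0) -> forall t, SU R n (W t).
Proof.
move=> [Wu Wdet] t; split.
  apply/unitarymxP; rewrite -(unitarymxP Wu).
  apply: (is_derive_mx_eq0 (F := fun t => W t *m (W t)^t*)) => s.
  apply: is_derive_mx_eq (is_derive_mxM (W_ode s) (is_derive_mxJ (W_ode s))) _.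
  by rewrite adjmxM (M_su s).1 mulNmx mulmxN mulmxA subrr.
rewrite -Wdet; apply: (is_derive_C_eq0 (c := fun t => \det (W t))) => s.
have := is_derive_det (W_ode s); congr is_derive_C.
by rewrite mxtrace_mulC mulmxA mul_adj_mx mul_scalar_mx mxtraceZ (M_su s).2 mulr0.
Qed.

Variable t0 : R.
Hypothesis W_SU : SU R n (W t0).

Let W_unitary t : W t \is unitarymx. Proof. by case: (trajectory_SU W_SU t). Qed.

Let dV t : R := \sum_k (f k * g k t) ^+ 2.

Let V_derive (t : R) : is_derive t 1 (fun s => V (W s)) (dV t).
Proof.
apply: is_derive_eq (is_derive_V (W_ode t)) _.
rewrite mulmx_sumr V_sum; apply: eq_bigr => k _.
by rewrite -scalemxAr V_Z -/(g k t); ring.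
Qed.

Let dV_ge k t : f k ^+ 2 * g k t ^+ 2 <= dV t.
Proof.
by rewrite -exprMn /dV (bigD1 k) //= lerDl sumr_ge0 // => j _; rewrite sqr_ge0.
Qed.

Lemma trajectory_V_nondecreasing s t : s <= t -> V (W s) <= V (W t).
Proof.
move=> st; have [c _ E] := MVT_unordered s t V_derive.
rewrite -subr_ge0 E mulr_ge0 ?subr_ge0 // sumr_ge0 // => j _; exact: sqr_ge0.
Qed.

Let g_bounded k : exists K, forall t, `|g k t| <= K.
Proof.
apply: (@bounded_V _ _ _ (fun t => W t *m S k t)).
by apply: bounded_mxM => //; exact: bounded_mx_unitary.
Qed.

Let M_bounded : bounded_mx M.
Proof.
apply: bounded_mx_sum => k; have [K gK] := g_bounded k.
apply: (bounded_mxZ (K := `|f k| * (`|f k| * K))) => // t.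
by rewrite !normrM !ler_wpM2l.
Qed.

(** Barbalat applies with v = V(W), bounded by n, and constant (f_k)^2, positive as f_k is nonzero.
    The derivative of [g k] is bounded because [W] is unitary and [S k], [dS k] and [M] are
    bounded. *)
Let g_cvg0 k : g k t @[t --> +oo] --> 0.
Proof.
pose dg t := W t *m M t *m S k t + W t *m dS k t.
have dgb : bounded_mx dg.
  have Wb := bounded_mx_unitary W_unitary.
  apply: bounded_mxD; last exact: bounded_mxM.
  by apply: bounded_mxM => //; exact: bounded_mxM.
have [K dgK] := bounded_V dgb.
apply: (@barbalat _ (fun t => V (W t)) dV (g k) (fun t => V (dg t)) (f k ^+ 2) K n%:R) => //.
- by rewrite exprn_even_gt0 //= f0.
- by move=> t; apply: is_derive_V; apply: is_derive_mxM.
- by move=> t; apply: unitary_V_le.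
Qed.

Let dW_cvg0 : limit_mx (+oo : set_system R) (fun t => W t *m M t) 0.
Proof.
have WSb k : bounded_mx (fun t => W t *m S k t).
  by apply: bounded_mxM => //; exact: bounded_mx_unitary.
move=> i j; rewrite mxE.
have h k : cvg_C +oo (fun t => (g k t)%:C * ((f k * f k)%:C * (W t *m S k t) i j)) 0.
  apply: cvg_C0_mul_bounded => //.
  by apply: bounded_CM; [exact: bounded_C_cst|exact: WSb].
have := cvg_C_sum _ (index_enum 'I_m) h; rewrite big1 // => /(_ _); congr cvg_C.
apply/funext => t; rewrite mulmx_sumr summxE; apply: eq_bigr => k _.
by rewrite -scalemxAr !mxE mulrA -rmorphM /=; congr (_%:C * _); ring.
Qed.

(** Periodicity freezes [S k] at its value at [s] along the times s + jT, so V(L S_k(s)) is a limit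
    of values of [g k]. Although [L] is a limit along an ultrafilter only, monotonicity makes V(L)
    the limit of V(W) in full. *)
Lemma trajectory_limit : exists L : 'M[R[i]]_n, [/\ SU R n L,
  V (W t) @[t --> +oo] --> V L, forall t, V (W t) <= V L &
  forall k s, V (L *m S k s) = 0].
Proof.
have [l Vl Vle] := nondecreasing_bounded_cvg trajectory_V_nondecreasing
  (fun t => unitary_V_le (W_unitary t)).
(* An ultrafilter replaces the successive extraction of subsequences, one for
   each matrix entry. *)
have [U [UU oU]] := ultraFilterLemma (F := \oo : set_system nat) _.
have jT s : (s + T *+ j) @[j --> U] --> (+oo : set_system R).
  apply/cvgryPge => A; apply: oU.
  have := nbhs_infty_ger (R := R) ((A - s) / T); apply: filterS => j.
  by rewrite ler_pdivrMr // mulr_natl lerBlDl.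
have cvgU (h : R -> R) (s x : R) : h t @[t --> +oo] --> x -> h (s + T *+ j) @[j --> U] --> x.
  by move=> hx; apply: cvg_comp hx; exact: jT.
(* The summand 0 gives these times the form s + jT required by [cvgU]. *)
have [L WL] : exists L, limit_mx U (fun j => W (0 + T *+ j)) L.
  by apply: bounded_mx_limit_ultra; apply: bounded_mx_unitary => j.
have VLl : V L = l.
  by apply: (cvg_unique (@norm_hausdorff _ _) (limit_V _ WL)); exact: (cvgU (fun t => V (W t))) Vl.
exists L; rewrite VLl; split => //.
  by apply: limit_SU WL => j; exact: trajectory_SU W_SU _.
move=> k s.
(* Over the fixed time [s] the displacement of [W] tends to 0 because W' does, so the shifted
   samples keep the limit [L]. *)
have WsL : limit_mx U (fun j => W (s + T *+ j)) L.
  have shift (h dh : R -> R) (x : R) : (forall t : R, is_derive t 1 h (dh t)) ->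
      dh t @[t --> +oo] --> 0 -> h (0 + T *+ j) @[j --> U] --> x ->
      h (s + T *+ j) @[j --> U] --> x.
    move=> hd dh0 hx.
    have hs := cvgU (fun t => h (t + s) - h t) 0 0 (cvg_shift_of_derive0 s hd dh0).
    have -> : (fun j => h (s + T *+ j)) =
        (fun j => (h (0 + T *+ j + s) - h (0 + T *+ j)) + h (0 + T *+ j)).
      by apply/funext => j; rewrite subrK add0r addrC.
    by rewrite -[x in _ --> x]add0r; exact: cvgD hs hx.
  move=> i j; have [d0 d1] := dW_cvg0 i j; have [w0 w1] := WL i j.
  rewrite !mxE in d0 d1.
  split.
    apply: (shift (fun t => complex.Re (W t i j)) _ _ _ d0 w0) => t.
    by case: (W_ode t i j).
  apply: (shift (fun t => complex.Im (W t i j)) _ _ _ d1 w1) => t.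
  by case: (W_ode t i j).
have UF : Filter U by exact: _.
have := limit_V UF (limit_mxM UF WsL (limit_mx_cst UF (S k s))).
have -> : (fun j => V (W (s + T *+ j) *m S k s)) = (fun j => g k (s + T *+ j)).
  by apply/funext => j; rewrite /g (periodicn (S_periodic k)).
by move=> h; apply: (cvg_unique (@norm_hausdorff _ _) h); exact: (cvgU (g k)) (g_cvg0 k).
Qed.

End Trajectory.

(** * The periodic reference *)

Section PeriodicBounded.
Variable R : realType.

Lemma periodicz (f : R -> R) (T : R) : periodic f T ->
  forall (z : int) a, f (a + T *~ z) = f a.
Proof.
move=> fT [k|k] a; first by rewrite -pmulrn (periodicn fT).
by rewrite NegzE mulrNz -pmulrn -[in RHS](subrK (T *+ k.+1) a) (periodicn fT).
Qed.

Lemma periodic_continuous_bounded (f : R -> R) (T : R) :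
  0 < T -> periodic f T -> continuous f -> exists K, forall t, `|f t| <= K.
Proof.
move=> T0 fT fc.
have [c _ cmax] : exists2 c, c \in `[0, T]%R &
    forall t, t \in `[0, T]%R -> `|f t| <= `|f c|.
  apply: (@EVT_max _ (fun t => `|f t|) 0 T (ltW T0)).
  by apply: continuous_subspaceT => t; apply: cvg_norm; exact: fc.
exists `|f c| => t.
(* Removing floor(t/T) periods brings [t] into [0, T], where the maximum was taken. *)
rewrite -(subrK (T *~ Num.floor (t / T)) t) (periodicz fT); apply: cmax.
have tT : t = (t / T) * T by rewrite divfK // gt_eqF.
rewrite in_itv /= -mulrzr {1 3}tT [T * _]mulrC -mulrBl.
have := Num.Theory.floor_le (t / T); have := Num.Theory.floorD1_gt (t / T).
rewrite intrD => h1 h2; apply/andP; split.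
  by rewrite mulr_ge0 ?subr_ge0 // ltW.
by rewrite ler_piMl ?ltW // ltrBlDl.
Qed.

End PeriodicBounded.

(** * Brackets carried back along the reference trajectory *)

Section Reference.
Variables (R : realType) (n m : nat) (H : 'I_m -> 'M[R[i]]_n) (T : R).
Variables (u : 'I_m -> R -> R) (X : R -> 'M[R[i]]_n) (Xinf : 'M[R[i]]_n).
Hypothesis H_su : forall k, su R n (H k).
Hypothesis T0 : 0 < T.
Hypothesis ref : regular_reference H T u X.
Hypothesis Xinf_unitary : Xinf \is unitarymx.

Let A := control_mx H u.
Let X_ode := ref_ode ref.
Let u_derivable k j (t : R) : derivable (derive1n j (u k)) t 1.
Proof. by case: ref => us *; exact: us. Qed.

Lemma control_mx_skew t : (A t)^t* = - A t.
Proof.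
rewrite /A /control_mx adjmx_sum -sumrN; apply: eq_bigr => k _.
by rewrite adjmxZ (H_su k).1 scalerN.
Qed.

(** Here [A] multiplies from the left, so it is X^* X whose derivative X^* (A^* + A) X vanishes at
    once; X X^* would only satisfy a commutator equation. *)
Lemma reference_unitary t : X t \is unitarymx.
Proof.
apply/unitarymxPl.
have -> : 1%:M = (X 0)^t* *m X 0 by rewrite (ref_init ref) trmx1 map_mx1 mulmx1.
apply: (is_derive_mx_eq0 (F := fun t => (X t)^t* *m X t)) => s.
apply: is_derive_mx_eq (is_derive_mxM (is_derive_mxJ (X_ode s)) (X_ode s)) _.
by rewrite adjmxM -/(A s) control_mx_skew mulmxN mulNmx mulmxA addNr.
Qed.

(* Every bracket has its entries in this algebra of curves, which is closed under
   differentiation; hence brackets of all orders are differentiable. *)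
Inductive control_algebra : (R -> R[i]) -> Prop :=
| control_algebra_cst z : control_algebra (fun=> z)
| control_algebra_u k j : control_algebra (fun t => (derive1n j (u k) t)%:C)
| control_algebra_X i j : control_algebra (fun t => X t i j)
| control_algebra_add c e : control_algebra c -> control_algebra e ->
    control_algebra (fun t => c t + e t)
| control_algebra_mul c e : control_algebra c -> control_algebra e ->
    control_algebra (fun t => c t * e t).

Definition control_algebra_mx (F : R -> 'M[R[i]]_n) :=
  forall i j, control_algebra (fun t => F t i j).

Lemma control_algebra_sum (I : Type) (r : seq I) (c : I -> R -> R[i]) :
  (forall k, control_algebra (c k)) -> control_algebra (fun t => \sum_(k <- r) c k t).
Proof.
move=> cA; elim: r => [|k r IH].
  by under eq_fun do rewrite big_nil; exact: control_algebra_cst.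
by under eq_fun do rewrite big_cons; exact: control_algebra_add.
Qed.

Lemma control_algebra_mxM F E : control_algebra_mx F -> control_algebra_mx E ->
  control_algebra_mx (fun t => F t *m E t).
Proof.
move=> FA EA i j; under eq_fun do rewrite mxE.
by apply: control_algebra_sum => k; exact: control_algebra_mul.
Qed.

Lemma control_algebra_control_mx : control_algebra_mx A.
Proof.
move=> i j; under eq_fun do rewrite summxE.
apply: control_algebra_sum => k; under eq_fun do rewrite mxE.
apply: control_algebra_mul; first exact: (control_algebra_u k 0).
exact: control_algebra_cst.
Qed.

Lemma control_algebra_derive c : control_algebra c ->
  exists2 d, control_algebra d & forall t, is_derive_C c t (d t).
Proof.
elim=> {c} [z|k j|i j|c e _ [dc dcA cd] _ [de deA ed]|c e cA [dc dcA cd] eA [de deA ed]].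
- by exists (fun=> 0) => [|t]; [exact: control_algebra_cst|exact: is_derive_C_cst].
- exists (fun t => (derive1n j.+1 (u k) t)%:C) => [|t]; first exact: control_algebra_u.
  apply: is_derive_C_real; rewrite derive1nS derive1E.
  exact: derivableP (@u_derivable k j t).
- exists (fun t => (A t *m X t) i j) => [|t]; last exact: X_ode.
  apply: control_algebra_mxM; first exact: control_algebra_control_mx.
  by move=> k l; exact: control_algebra_X.
- exists (fun t => dc t + de t) => [|t]; first exact: control_algebra_add.
  exact: is_derive_CD.
- exists (fun t => dc t * e t + c t * de t) => [|t]; last exact: is_derive_CM.
  by apply: control_algebra_add; apply: control_algebra_mul.
Qed.

(** Turns the total operator [derive_mx] inside [bracket] into a genuine derivative that stays in
    the algebra, which drives the induction on the order. *)
Lemma control_algebra_derive_mx F : control_algebra_mx F ->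
  control_algebra_mx (Defs.derive_mx F) /\
  forall t, is_derive_mx F t (Defs.derive_mx F t).
Proof.
move=> FA.
have /choice[D DF] (p : 'I_n * 'I_n) : exists d, control_algebra d /\
    forall t, is_derive_C (fun s => F s p.1 p.2) t (d t).
  by have [d] := control_algebra_derive (FA p.1 p.2); exists d.
have FD t : is_derive_mx F t (\matrix_(i, j) D (i, j) t).
  by move=> i j; rewrite mxE; exact: (DF (i, j)).2.
have E t : Defs.derive_mx F t = \matrix_(i, j) D (i, j) t by exact: derive_mx_val.
split=> [i j|t]; last by rewrite E.
by under eq_fun do rewrite E mxE; exact: (DF (i, j)).1.
Qed.

Lemma control_algebra_bracket k j : control_algebra_mx (bracket H u X k j).
Proof.
elim: j => [|j IH] /=.
  apply: control_algebra_mxM => [i l|i l]; first exact: control_algebra_cst.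
  exact: control_algebra_X.
have [dA _] := control_algebra_derive_mx IH.
move=> i l; under eq_fun do rewrite mxE mulNmx mxE -mulN1r.
apply: control_algebra_add (dA i l); apply: control_algebra_mul.
  exact: control_algebra_cst.
by apply: control_algebra_mxM => //; exact: control_algebra_control_mx.
Qed.

Let Xr t := X t *m Xinf.

Let Xr_unitary t : Xr t \is unitarymx.
Proof. by apply: mul_unitarymx Xinf_unitary; exact: reference_unitary. Qed.

(** This is the j-th derivative of X_r^* H_k X_r. The right factor is only [Xinf] because the
    bracket already contains [X]. *)
Definition transported_bracket k j t := (Xr t)^t* *m bracket H u X k j t *m Xinf.

(** Differentiating the left factor contributes - X_r^* A, exactly the correction term in the
    recursion for [bracket]. *)
Lemma transported_bracket_derive k j t :
  is_derive_mx (transported_bracket k j) t (transported_bracket k j.+1 t).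
Proof.
have [_ Bd] := control_algebra_derive_mx (control_algebra_bracket k j).
have Xrd : is_derive_mx Xr t (A t *m Xr t).
  apply: is_derive_mx_eq (is_derive_mxM (X_ode t) (is_derive_mx_cst Xinf t)) _.
  by rewrite mulmx0 addr0 mulmxA.
apply: is_derive_mx_eq (is_derive_mxM (is_derive_mxM (is_derive_mxJ Xrd) (Bd t))
  (is_derive_mx_cst Xinf t)) _.
rewrite mulmx0 addr0 /transported_bracket /= -/A; congr (_ *m _).
by rewrite mulmxDr adjmxM control_mx_skew mulmxA.
Qed.

Lemma transported_bracket0 k t : transported_bracket k 0 t = (Xr t)^t* *m H k *m Xr t.
Proof. by rewrite /transported_bracket /= /Xr !mulmxA. Qed.

Lemma transported_bracket0_su k t : su R n (transported_bracket k 0 t).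
Proof.
rewrite transported_bracket0; exact: su_conj (Xr_unitary t) (H_su k).
Qed.

Lemma transported_bracket0_periodic k : periodic (transported_bracket k 0) T.
Proof. by move=> t; rewrite !transported_bracket0 /Xr (ref_periodic ref). Qed.

Lemma transported_bracket0_bounded k : bounded_mx (transported_bracket k 0).
Proof.
rewrite (_ : transported_bracket k 0 = (fun t => (Xr t)^t* *m H k *m Xr t)).
  apply: bounded_mxM; last exact: bounded_mx_unitary.
  by apply: bounded_mxM; [apply/bounded_mxJ/bounded_mx_unitary|exact: bounded_mx_cst].
by apply/funext => t; exact: transported_bracket0.
Qed.

(** Supplies the derivative bound for Barbalat's lemma: the controls are bounded as continuous
    periodic functions, and [X] is unitary. *)
Lemma transported_bracket1_bounded k : bounded_mx (transported_bracket k 1).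
Proof.
have Ab : bounded_mx A.
  apply: bounded_mx_sum => l; have [|K uK] := periodic_continuous_bounded T0
    (ref_control_periodic ref l).
    move=> t; apply/differentiable_continuous/derivable1_diffP.
    exact: (@u_derivable l 0 t).
  by apply: bounded_mxZ uK _; exact: bounded_mx_cst.
have Xb : bounded_mx X by apply: bounded_mx_unitary; exact: reference_unitary.
have Hb : bounded_mx (fun _ : R => H k) by exact: bounded_mx_cst.
have HXb := bounded_mxM Hb Xb.
(* The derivative of H X is H A X by the reference equation. The minus sign is written as a real
   scaling to fit [bounded_mxZ]. *)
rewrite (_ : transported_bracket k 1 = (fun t => (Xr t)^t* *m
    ((-1)%:C *: (A t *m (H k *m X t)) + H k *m (A t *m X t)) *m Xinf)).
  apply: bounded_mxM; last exact: bounded_mx_cst.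
  apply: bounded_mxM; first exact/bounded_mxJ/bounded_mx_unitary.
  apply: bounded_mxD; last by apply: bounded_mxM => //; exact: bounded_mxM.
  by apply: (bounded_mxZ (K := 1)) => [t|]; [rewrite normrN1|exact: bounded_mxM].
apply/funext => t; rewrite /transported_bracket /= -/A; congr (_ *m (_ + _) *m _).
  by rewrite mulNmx rmorphN1 scaleN1r.
apply: derive_mx_val.
apply: is_derive_mx_eq (is_derive_mxM (is_derive_mx_cst (H k) t) (X_ode t)) _.
by rewrite mul0mx add0r.
Qed.

(** A function of [t] that vanishes identically has zero derivative, so the hypothesis climbs to
    every order; at t = 0, where X is the identity, the span condition applies. *)
Lemma transported_bracket_critical (L : 'M[R[i]]_n) :
  (forall k t, V (L *m transported_bracket k 0 t) = 0) ->
  forall Z, su R n Z -> V (L *m Z) = 0.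
Proof.
move=> L0.
have Lj j k t : V (L *m transported_bracket k j t) = 0.
  elim: j t => [//|j IH] t.
  have := is_derive_V (is_derive_mxM (is_derive_mx_cst L t)
    (transported_bracket_derive k j t)).
  rewrite mul0mx add0r; under eq_fun do rewrite IH.
  by move=> /@derive_val <-; rewrite derive_cst.
move=> Z Zsu.
(* At 0 the transported brackets are the brackets conjugated by [Xinf], so the conjugate of [Z] is
   expanded instead of [Z]. *)
have [N [c [Y [YB ZE]]]] : real_span [set Z | exists (k : 'I_m) (j : nat),
    Z = bracket H u X k j 0] (Xinf *m Z *m Xinf^t*).
  rewrite (ref_span ref) -{1}(trmxCK Xinf); apply: su_conj Zsu.
  by rewrite trmxC_unitary.
have -> : Z = Xinf^t* *m (Xinf *m Z *m Xinf^t*) *m Xinf.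
  have XX := (unitarymxPl Xinf).2 Xinf_unitary.
  by rewrite !mulmxA XX mul1mx -mulmxA XX mulmx1.
rewrite ZE mulmx_sumr mulmx_suml mulmx_sumr V_sum big1 // => l _.
rewrite -scalemxAr -scalemxAl -scalemxAr V_Z.
have [k [j ->]] := YB l.
by have := Lj j k 0; rewrite /transported_bracket /Xr (ref_init ref) mul1mx => ->; rewrite mulr0.
Qed.

End Reference.

Theorem theorem1 (R : realType) (n m : nat) (hn : (2 <= n)%N)
    (H : 'I_m -> 'M[R[i]]_n) (hH : forall k : 'I_m, su R n (H k))
    (hreg : regular H)
    (T : R) (hT : 0 < T) (u : 'I_m -> R -> R) (XrT : R -> 'M[R[i]]_n)
    (href : regular_reference H T u XrT)
    (Xinf : 'M[R[i]]_n) (hXinf : SU R n Xinf)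
    (f : 'I_m -> R) (hf : forall k : 'I_m, f k != 0) :
  finite_set (G R n) /\
  G R n n%:R /\
  is_max (G R n) n%:R /\
  exists delta : R,
    is_max (G R n `\ n%:R) delta /\
    forall (t0 : R) (W0 : 'M[R[i]]_n), SU R n W0 ->
    forall W : R -> 'M[R[i]]_n,
      aux_solution H f (fun t : R => XrT t *m Xinf) t0 W0 W ->
      delta < V W0 -> cvg_mx W 1%:M.
Proof.
have n0 : (0 < n)%N by exact: ltnW.
have Gfin := @G_finite R n n0.
split=> //; split; first exact: G_n.
split; first by split=> [|x]; [exact: G_n|exact: G_le].
have [||delta dmax] := @finite_max R (G R n `\ n%:R).
- by apply: sub_finite_set Gfin => x [].
- exact: G_nontrivial.
exists delta; split=> // t0 W0 W0_SU W [Wt0 W_ode] dW0.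
have Xinfu : Xinf \is unitarymx by case: hXinf.
(* Orders 0 and 1 play the roles of [S] and [dS] in the trajectory section. *)
pose S k j := transported_bracket H u XrT Xinf k j.
have SE k t : (XrT t *m Xinf)^t* *m H k *m (XrT t *m Xinf) = S k 0 t.
  by rewrite /S transported_bracket0.
(* Moving X_r^* inside the sum gives the equation the form W' = W M. *)
have W_ode' t : is_derive_mx W t
    (W t *m \sum_k (f k * (f k * V (W t *m S k 0 t)))%:C *: S k 0 t).
  apply: is_derive_mx_eq (W_ode t) _.
  rewrite /aux_field -mulmxA mulmx_sumr; congr (_ *m _); apply: eq_bigr => k _.
  by rewrite -scalemxAr /feedback -SE !mulmxA.
have SU0 : SU R n (W t0) by rewrite Wt0.
have [L [L_SU VL VleL Lcrit]] := trajectory_limit hT hf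
  (transported_bracket0_su hH href Xinfu)
  (transported_bracket0_periodic _ href)
  (fun k t => transported_bracket_derive Xinf hH href k 0 t)
  (transported_bracket0_bounded hH href Xinfu)
  (transported_bracket1_bounded hH hT href Xinfu) W_ode' SU0.
have GL : G R n (V L).
  by apply: critical_V_in_G => //; exact: (transported_bracket_critical hH href Xinfu).
have dL : delta < V L.
  by apply: lt_le_trans dW0 _; rewrite -Wt0.
have VLn : V L = n%:R.
  apply: contrapT => /eqP VLn.
  have : V L <= delta by apply: dmax.2; split=> //; exact/eqP.
  by rewrite leNgt dL.
rewrite /cvg_mx.
have -> : (fun t => euclidean_norm (W t - 1%:M)) = (fun t => Num.sqrt (2 * (n%:R - V (W t)))).
  apply/funext => t; apply: unitary_sub1_norm.
  by case: (trajectory_SU (transported_bracket0_su hH href Xinfu) W_ode' SU0 t).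
have V0 : 2 * (n%:R - V (W t)) @[t --> +oo] --> 2 * (n%:R - V L).
  by apply: cvgMr; apply: cvgB => //; exact: cvg_cst.
have : Num.sqrt (2 * (n%:R - V (W t))) @[t --> +oo] --> Num.sqrt (2 * (n%:R - V L)).
  by apply: continuous_cvg V0; exact: sqrt_continuous.
by rewrite VLn subrr mulr0 sqrtr0.
Qed.
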